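(* In the abstract boundary problem setting described in the context, let $A$ be a self-adjoint operator in $H_0$ with $T\subset A\subset T^*$, $\mathcal D(A)=\operatorname{Ker}\gamma_0$, and such that $A$ has a bounded everywhere defined inverse. Then $\Gamma_0$ restricts to a topological isomorphism $\operatorname{Ker}T^*\to K'$, and $T^*\oplus\Gamma_0:\mathcal D(T^* )\to H_0\oplus K'$ is a topological isomorphism (with the graph topology on $\mathcal D(T^* )$).
   Context: Inner products are linear in the first argument and conjugate-linear in the second. Let $H_0$ be a separable Hilbert space with inner product $\langle\cdot,\cdot\rangle$, let $T$ be a closed densely defined symmetric operator in $H_0$ with adjoint $T^*$, and equip $\mathcal D(T^* )$ with the graph norm. Let $H_1\subset H_0$ be a dense subspace which is a Hilbert space in its own right with bounded inclusion $H_1\to H_0$. Let $K^\partial$ be a separable Hilbert space with inner product $\langle\cdot,\cdot\rangle_\partial$ and $K\subset K^\partial$ a dense subspace which is a Hilbert space in its own right with bounded inclusion. Let $K'$ be the space of continuous anti-linear functionals on $K$ (a Hilbert space with the dual norm); $K^\partial$ is regarded as a dense subspace of $K'$ via $y\mapsto(x\mapsto\langle y,x\rangle_\partial)$, so $K\subset K^\partial\subset K'$. For $y\in K'$, $x\in K$ put $\langle y,x\rangle_{K',K}=y(x)$ and $\langle x,y\rangle_{K,K'}=\overline{y(x)}$; these agree with $\langle\cdot,\cdot\rangle_\partial$ when $y\in K^\partial$. Standing assumptions: $H_1\subset\mathcal D(T^* )$ and $H_1$ is dense in $\mathcal D(T^* )$ in the graph norm; $T^*|_{H_1}:H_1\to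 H_0$ is bounded; $\gamma_0,\gamma_1:H_1\to K$ are bounded linear operators such that $\gamma=\gamma_0\oplus\gamma_1:H_1\to K\oplus K$ is surjective; $\operatorname{Ker}\gamma$ is dense in $H_0$ and $\mathcal D(T)=\operatorname{Ker}\gamma$; and the Lagrange identity $\langle T^*u,v\rangle-\langle u,T^*v\rangle=\langle\gamma_1u,\gamma_0v\rangle_\partial-\langle\gamma_0u,\gamma_1v\rangle_\partial$ holds for all $u,v\in H_1$. $\Gamma_0,\Gamma_1:\mathcal D(T^* )\to K'$ denote the (existing, unique) continuous extensions of $\gamma_0,\gamma_1$; they satisfy $\langle T^*u,v\rangle-\langle u,T^*v\rangle=\langle\Gamma_1u,\Gamma_0v\rangle_{K',K}-\langle\Gamma_0u,\Gamma_1v\rangle_{K',K}$ for $u\in\mathcal D(T^* )$, $v\in H_1$. *)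

(* Defs.v *)
(* MathComp + mathcomp-real-closed (complex) + classical_sets/reals
   from MathComp-Analysis (for [sup]).  Scalars: C := R[i] with R : realType. *)
From mathcomp Require Import all_boot all_order all_algebra.
From mathcomp Require Import complex.
From mathcomp Require Import classical_sets reals.
Import GRing.Theory Num.Theory.
Set Implicit Arguments. Unset Strict Implicit. Unset Printing Implicit Defensive.
Local Open Scope ring_scope.

(* modulus of a complex number *)
Definition cabs (R : realType) (z : R[i]) : R :=
  Num.sqrt (complex.Re z ^+ 2 + complex.Im z ^+ 2).

(* ip is an inner product, linear in the first argument, conjugate-linear
   in the second *)
Definition inner_product (R : realType) (V : lmodType R[i]) (ip : V -> V -> R[i]) : Prop :=
  [/\ (forall (a : R[i]) (x y z : V), ip (a *: x + y) z = a * ip x z + ip y z),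
      (forall x y : V, ip y x = (ip x y)^*),
      (forall x : V, 0 <= ip x x) &
      (forall x : V, ip x x = 0 -> x = 0)].

(* norm induced by ip *)
Definition vnorm (R : realType) (V : lmodType R[i]) (ip : V -> V -> R[i]) (x : V) : R :=
  Num.sqrt (complex.Re (ip x x)).

(* completeness: every Cauchy sequence converges *)
Definition complete_ip (R : realType) (V : lmodType R[i]) (ip : V -> V -> R[i]) : Prop :=
  forall u : nat -> V,
    (forall e : R, 0 < e -> exists N : nat, forall m n : nat,
        (N <= m)%N -> (N <= n)%N -> vnorm ip (u m - u n) < e) ->
    exists l : V, forall e : R, 0 < e -> exists N : nat, forall n : nat,
        (N <= n)%N -> vnorm ip (u n - l) < e.

(* (V, ip) is a (complex) Hilbert space *)
Definition hilbert (R : realType) (V : lmodType R[i]) (ip : V -> V -> R[i]) : Prop :=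
  inner_product ip /\ complete_ip ip.

(* separability: a countable dense subset *)
Definition separable (R : realType) (V : lmodType R[i]) (ip : V -> V -> R[i]) : Prop :=
  exists s : nat -> V, forall (x : V) (e : R), 0 < e -> exists n : nat, vnorm ip (x - s n) < e.

(* density of a subset w.r.t. a (semi)norm nrm *)
Definition dense_wrt (R : realType) (V : lmodType R[i]) (nrm : V -> R) (S : V -> Prop) : Prop :=
  forall (x : V) (e : R), 0 < e -> exists y : V, S y /\ nrm (x - y) < e.

Definition is_linear (R : realType) (U V : lmodType R[i]) (f : U -> V) : Prop :=
  forall (a : R[i]) (x y : U), f (a *: x + y) = a *: f x + f y.

(* bounded w.r.t. given norms *)
Definition bounded_wrt (R : realType) (U V : Type) (nU : U -> R) (nV : V -> R) (f : U -> V) : Prop :=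
  exists M : R, forall x : U, nV (f x) <= M * nU x.

(* linear subspace *)
Definition subspace (R : realType) (V : lmodType R[i]) (D : V -> Prop) : Prop :=
  D 0 /\ forall (a : R[i]) (x y : V), D x -> D y -> D (a *: x + y).

(* a linear operator in V, given by its domain D and action T (values of T off D are irrelevant) *)
Definition lin_op (R : realType) (V : lmodType R[i]) (D : V -> Prop) (T : V -> V) : Prop :=
  subspace D /\ forall (a : R[i]) (x y : V), D x -> D y -> T (a *: x + y) = a *: T x + T y.

(* convergence in the norm of ip *)
Definition converges (R : realType) (V : lmodType R[i]) (ip : V -> V -> R[i]) (u : nat -> V) (l : V) : Prop :=
  forall e : R, 0 < e -> exists N : nat, forall n : nat, (N <= n)%N -> vnorm ip (u n - l) < e.

(* closed operator: closed graph *)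
Definition closed_op (R : realType) (V : lmodType R[i]) (ip : V -> V -> R[i]) (D : V -> Prop) (T : V -> V) : Prop :=
  forall (u : nat -> V) (x y : V), (forall n, D (u n)) ->
    converges ip u x -> converges ip (fun n => T (u n)) y -> D x /\ T x = y.

Definition symmetric_op (R : realType) (V : lmodType R[i]) (ip : V -> V -> R[i]) (D : V -> Prop) (T : V -> V) : Prop :=
  forall u v : V, D u -> D v -> ip (T u) v = ip u (T v).

(* (Ds, Ts) is the adjoint of the densely defined operator (D, T) *)
Definition is_adjoint (R : realType) (V : lmodType R[i]) (ip : V -> V -> R[i])
    (D : V -> Prop) (T : V -> V) (Ds : V -> Prop) (Ts : V -> V) : Prop :=
  (forall v : V, Ds v <-> exists w : V, forall u : V, D u -> ip (T u) v = ip u w) /\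
  (forall u v : V, D u -> Ds v -> ip (T u) v = ip u (Ts v)).

(* graph norm of (Ds, Ts) *)
Definition graphnorm (R : realType) (V : lmodType R[i]) (ip : V -> V -> R[i]) (Ts : V -> V) (v : V) : R :=
  Num.sqrt (vnorm ip v ^+ 2 + vnorm ip (Ts v) ^+ 2).

(* K' : continuous anti-linear functionals on (K, ipK) *)
Definition antidual (R : realType) (K : lmodType R[i]) (ipK : K -> K -> R[i]) (phi : K -> R[i]) : Prop :=
  (forall (a : R[i]) (x y : K), phi (a *: x + y) = a^* * phi x + phi y) /\
  (exists M : R, forall x : K, cabs (phi x) <= M * vnorm ipK x).

(* dual norm on K' *)
Definition dnorm (R : realType) (K : lmodType R[i]) (ipK : K -> K -> R[i]) (phi : K -> R[i]) : R :=
  sup [set cabs (phi x) | x in [set x : K | vnorm ipK x <= 1]]%classic.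

(* norm on the Hilbert sum H0 (+) K' *)
Definition sumnorm (R : realType) (H : lmodType R[i]) (ipH : H -> H -> R[i])
    (K : lmodType R[i]) (ipK : K -> K -> R[i]) (p : H * (K -> R[i])) : R :=
  Num.sqrt (vnorm ipH p.1 ^+ 2 + dnorm ipK p.2 ^+ 2).

(* f restricted to S is a topological (linear) isomorphism of S onto Tg:
   it maps S bijectively onto Tg, is bounded, and has a bounded inverse *)
Definition top_iso (R : realType) (X Y : Type) (S : X -> Prop) (Tg : Y -> Prop)
    (nX : X -> R) (nY : Y -> R) (f : X -> Y) : Prop :=
  [/\ (forall x, S x -> Tg (f x)),
      (forall x1 x2, S x1 -> S x2 -> f x1 = f x2 -> x1 = x2),
      (forall y, Tg y -> exists2 x, S x & f x = y),
      (exists M : R, forall x, S x -> nY (f x) <= M * nX x) &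
      (exists c : R, forall x, S x -> nX x <= c * nY (f x))].

(* Main.v *)
(* Write [B] for the inverse of [A] and [L f] for [B f] viewed in [H1].  By the
   closed graph theorem [L : H0 -> H1] is bounded, hence so is [P := g1 o L].
   Since [g0 (L f) = 0], the Lagrange identity extended by density reads
   [<u, f> = <Ts u, B f> + (G0 u)(P f)] for [u] in [Ds] and [f] in [H0].
   On [Ker Ts] this is [<u, f> = (G0 u)(P f)]: it gives injectivity of [G0] and
   [|u| <= |P| |G0 u|], and, given [phi] in [K'], the Riesz vector of
   [f |-> phi (P f)] is the preimage of [phi].  The second isomorphism follows
   from the decomposition [v = B (Ts v) + (v - B (Ts v))], as [G0] vanishes on
   the range of [B]. *)

Require Import Defs.
From mathcomp Require Import all_boot all_order all_algebra.
From mathcomp Require Import complex.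
From mathcomp Require Import boolp classical_sets reals.
From mathcomp Require Import ring lra.
Set Implicit Arguments. Unset Strict Implicit. Unset Printing Implicit Defensive.
Import Order.TTheory GRing.Theory Num.Theory.
Local Open Scope ring_scope.
Local Open Scope complex_scope.

(** * Inner product geometry, carried out on real parts *)

Section InnerProduct.
Variables (R : realType) (V : lmodType R[i]) (ip : V -> V -> R[i]).
Hypothesis ipP : inner_product ip.

Lemma conjE (z : R[i]) : Num.conj z = conjc z.
Proof. by []. Qed.

Lemma ip0l z : ip 0 z = 0.
Proof.
case: ipP => lin _ _ _; have := lin 1 0 0 z.
by rewrite scale1r addr0 mul1r => /(congr1 (fun w => w - ip 0 z)); rewrite addrK subrr.
Qed.

Lemma ipDl x y z : ip (x + y) z = ip x z + ip y z.
Proof. by case: ipP => lin _ _ _; have := lin 1 x y z; rewrite scale1r mul1r. Qed.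

Lemma ipZl a x z : ip (a *: x) z = a * ip x z.
Proof.
by case: ipP => lin _ _ _; have := lin a x 0 z; rewrite ip0l !addr0.
Qed.

Lemma ipC x y : ip y x = Num.conj (ip x y).
Proof. by case: ipP. Qed.

Lemma ipDr x y z : ip x (y + z) = ip x y + ip x z.
Proof. by rewrite ipC ipDl rmorphD /= -!ipC. Qed.

Lemma ipZr a x y : ip x (a *: y) = Num.conj a * ip x y.
Proof. by rewrite ipC ipZl rmorphM /= -!ipC. Qed.

Lemma ip0r x : ip x 0 = 0.
Proof. by rewrite ipC ip0l rmorph0. Qed.

Lemma ipBl x y z : ip (x - y) z = ip x z - ip y z.
Proof. by rewrite -scaleN1r ipDl ipZl mulN1r. Qed.

Lemma ipBr x y z : ip x (y - z) = ip x y - ip x z.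
Proof. by rewrite -scaleN1r ipDr ipZr rmorphN1 mulN1r. Qed.

Local Notation rip x y := (complex.Re (ip x y)).
Local Notation n := (vnorm ip).

Lemma ReZ (a : R) (z : R[i]) : complex.Re (a%:C * z) = a * complex.Re z.
Proof. by case: z => b c /=; rewrite mul0r subr0. Qed.

Lemma ripZl (a : R) x y : rip (a%:C *: x) y = a * rip x y.
Proof. by rewrite ipZl ReZ. Qed.

Lemma ripC x y : rip x y = rip y x.
Proof. by rewrite (ipC y) conjE; case: (ip y x). Qed.

Lemma ripZr (a : R) x y : rip x (a%:C *: y) = a * rip x y.
Proof. by rewrite ripC ripZl ripC. Qed.

Lemma ip_ge0 x : 0 <= rip x x.
Proof. by case: ipP => _ _ /(_ x) + _; case: (ip x x) => a b /=; rewrite lecE /= => /andP[]. Qed.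

Lemma vnorm_sqr x : n x ^+ 2 = rip x x.
Proof. by rewrite sqr_sqrtr // ip_ge0. Qed.

Lemma vnorm_ge0 x : 0 <= n x.
Proof. exact: sqrtr_ge0. Qed.

Lemma vnorm0 : n 0 = 0.
Proof. by rewrite /vnorm ip0l sqrtr0. Qed.

Lemma vnorm0_eq0 x : n x = 0 -> x = 0.
Proof.
move=> nx0; case: ipP => _ _ pos; apply.
have := vnorm_sqr x; have := pos x; rewrite nx0 expr0n /=.
by case: (ip x x) => a b; rewrite lecE /= => /andP[/eqP-> _] <-.
Qed.

Lemma vnormZ (a : R) x : n (a%:C *: x) = `|a| * n x.
Proof.
by rewrite /vnorm ripZl ripZr mulrA -expr2 sqrtrM ?sqr_ge0// sqrtr_sqr.
Qed.

Lemma vnormN x : n (- x) = n x.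
Proof.
have -> : - x = (-1)%:C *: x by rewrite rmorphN1 scaleN1r.
by rewrite vnormZ normrN1 mul1r.
Qed.

Lemma vnormBC x y : n (x - y) = n (y - x).
Proof. by rewrite -vnormN opprB. Qed.

Lemma vnormD_sqr x y : n (x + y) ^+ 2 = n x ^+ 2 + 2 * rip x y + n y ^+ 2.
Proof.
by rewrite !vnorm_sqr ipDl !ipDr !raddfD /= (ripC y x); ring.
Qed.

Lemma cauchy_schwarz x y : `|rip x y| <= n x * n y.
Proof.
have [/eqP/vnorm0_eq0->|ny0] := boolP (n y == 0).
  by rewrite ip0r vnorm0 mulr0 normr0.
have ny : 0 < n y by rewrite lt_def ny0 vnorm_ge0.
rewrite -(@ler_pXn2r _ 2) ?nnegrE ?normr_ge0 ?mulr_ge0 ?vnorm_ge0//.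
rewrite real_normK ?num_real//.
(* This [s] minimizes the norm of [x + s y] over real [s]. *)
set t := rip x y; set s := - t / n y ^+ 2.
have := sqr_ge0 (n (x + s%:C *: y)).
rewrite vnormD_sqr ripZr -/t vnormZ exprMn real_normK ?num_real //.
have -> : n x ^+ 2 + 2 * (s * t) + s ^+ 2 * n y ^+ 2 = n x ^+ 2 - t ^+ 2 / n y ^+ 2.
  by rewrite /s; field.
by rewrite subr_ge0 ler_pdivrMr ?exprn_gt0// exprMn.
Qed.

Lemma vnormD x y : n (x + y) <= n x + n y.
Proof.
rewrite -(@ler_pXn2r _ 2) ?nnegrE ?addr_ge0 ?vnorm_ge0//.
rewrite vnormD_sqr sqrrD.
have := ler_norm (rip x y); have := cauchy_schwarz x y; lra.
Qed.

Lemma vnormB x y : n (x - y) <= n x + n y.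
Proof. by rewrite -(vnormN y) vnormD. Qed.

Lemma vnorm_dist y x z : n (x - z) <= n (x - y) + n (y - z).
Proof. by rewrite -[x - z](subrKA y) vnormD. Qed.

Lemma parallelogram x y : n (x + y) ^+ 2 + n (x - y) ^+ 2 = 2 * (n x ^+ 2 + n y ^+ 2).
Proof.
rewrite !vnorm_sqr !ipDl !ipBr !ipDr !raddfD /= !raddfN /= -[- y]scaleN1r.
rewrite !ipZl !mulN1r !raddfN /=; ring.
Qed.

Lemma converges_unique (u : nat -> V) x y :
  converges ip u x -> converges ip u y -> x = y.
Proof.
move=> ux uy; apply/subr0_eq/vnorm0_eq0/eqP; rewrite eq_le vnorm_ge0 andbT.
apply/ler_addgt0Pl => e e0; rewrite addr0.
have e2 : 0 < e / 2 by rewrite divr_gt0.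
have [N1 h1] := ux _ e2; have [N2 h2] := uy _ e2.
have := h1 _ (leq_maxl N1 N2); have := h2 _ (leq_maxr N1 N2).
have := vnorm_dist (u (maxn N1 N2)) x y; rewrite (vnormBC x (u _)); lra.
Qed.

(** Were [w] nonzero, some [y] in [S] would lie closer to [w] than [|w|]; then [|w|^2 = Re <w, w -
    y> <= |w| |w - y| < |w|^2]. *)
Lemma dense_ortho (S : V -> Prop) w :
  dense_wrt n S -> (forall y, S y -> ip w y = 0) -> w = 0.
Proof.
move=> dS w0; apply: vnorm0_eq0; apply/eqP/contraT => nw0.
have nw : 0 < n w by rewrite lt_def nw0 vnorm_ge0.
have [y [Sy ly]] := dS w _ nw.
have := ler_norm (rip w (w - y)); have := cauchy_schwarz w (w - y).
rewrite ipBr (w0 y Sy) subr0 -vnorm_sqr expr2 => h1 h2.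
have := le_trans h2 h1; rewrite ler_pM2l // leNgt ly //.
Qed.

End InnerProduct.

(** * Completeness and Riesz representation *)

Section Complete.
Variables (R : realType) (V : lmodType R[i]) (ip : V -> V -> R[i]).
Hypothesis hV : hilbert ip.
Local Notation n := (vnorm ip).

Lemma exp_half_lt (c e : R) : 0 < e -> exists N : nat, forall k, (N <= k)%N -> c / 2 ^+ k < e.
Proof.
move=> e0; exists (Num.bound `|c / e|) => k Nk.
rewrite ltr_pdivrMr ?exprn_gt0// mulrC -ltr_pdivrMr//.
have : c / e < (Num.bound `|c / e|)%:R.
  by apply: le_lt_trans (ler_norm _) _; apply: archi_boundP.
move/lt_trans; apply; rewrite -natrX ltr_nat.
by apply: leq_ltn_trans Nk _; rewrite ltn_expl.
Qed.

(** As [d] at least halves, the steps from index [k] on sum to at most [d k]. This one estimate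
    serves minimizing sequences, shrinking balls and successive approximation. *)
Lemma geometric_limit (u : nat -> V) (d : nat -> R) :
  (forall k, 0 <= d k) -> (forall k, d k.+1 <= d k / 2) ->
  (forall k, n (u k.+1 - u k) <= d k / 2) ->
  exists l, converges ip u l /\ forall k, n (l - u k) <= d k.
Proof.
move=> d0 dS uS; have [ipP cV] := hV.
have near m k : (m <= k)%N -> n (u k - u m) <= d m.
  move=> /subnK; move: (k - m)%N => i <-; elim: i m => [|i IH] p.
    by rewrite subrr vnorm0.
  (* The first step costs [d p / 2]; the rest, counted from [p.+1], costs [d p.+1 <= d p / 2]. *)
  have := IH p.+1; have := uS p; have := dS p.
  have := vnorm_dist ipP (u p.+1) (u (i.+1 + p)%N) (u p).
  by rewrite addSnnS; lra.
have dlt k : d k <= d 0%N / 2 ^+ k.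
  elim: k => [|k IH]; first by rewrite expr0 divr1.
  apply: le_trans (dS k) _; rewrite exprS invfM mulrA mulrAC.
  by rewrite ler_pM2r // invr_gt0.
have [|l ul] := cV u.
  move=> e e0; have e2 : 0 < e / 2 by rewrite divr_gt0.
  have [N hN] := exp_half_lt (d 0%N) e2; exists N => p q Np Nq.
  have := hN _ (leqnn N); have := dlt N; have := near _ _ Np; have := near _ _ Nq.
  by have := vnorm_dist ipP (u N) (u p) (u q); rewrite (vnormBC ipP (u N)); lra.
exists l; split=> // k; apply/ler_addgt0Pr => e e0.
have [N hN] := ul e e0; have := hN _ (leq_maxl N k).
have := near _ _ (leq_maxr N k); have := vnorm_dist ipP (u (maxn N k)) l (u k).
by rewrite (vnormBC ipP l (u (maxn N k))); lra.
Qed.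

Definition antilinear (psi : V -> R[i]) :=
  forall a x y, psi (a *: x + y) = Num.conj a * psi x + psi y.

Lemma antilinear0 psi : antilinear psi -> psi 0 = 0.
Proof.
move=> lin; have := lin 1 0 0.
by rewrite scale1r addr0 rmorph1 mul1r => /(congr1 (fun w => w - psi 0)); rewrite addrK subrr.
Qed.

Lemma antilinearD psi x y : antilinear psi -> psi (x + y) = psi x + psi y.
Proof. by move=> lin; have := lin 1 x y; rewrite scale1r rmorph1 mul1r. Qed.

Lemma antilinearZ psi a x : antilinear psi -> psi (a *: x) = Num.conj a * psi x.
Proof. by move=> lin; have := lin a x 0; rewrite antilinear0 ?addr0. Qed.

Lemma antilinear_ReZ psi (a : R) x :
  antilinear psi -> complex.Re (psi (a%:C *: x)) = a * complex.Re (psi x).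
Proof.
by move=> lin; rewrite antilinearZ // conjE; case: (psi x) => b c /=; rewrite oppr0 mul0r subr0.
Qed.

(** For antilinear [f], [Im (f x) = Re (f (i x))], so real parts determine the functional. *)
Lemma antilinear_ext (f g : V -> R[i]) : antilinear f -> antilinear g ->
  (forall x, complex.Re (f x) = complex.Re (g x)) -> forall x, f x = g x.
Proof.
move=> fl gl e x; apply/eqP; rewrite eq_complex e eqxx /=; apply/eqP.
have := e ('i%C *: x); rewrite !antilinearZ // !conjE.
by case: (f x) (g x) => [a b] [c d] /=; rewrite !mul0r !mulN1r !opprK !add0r.
Qed.

(* The representing vector minimizes [J x = |x|^2 - 2 Re (psi x)]; minimizing
   sequences are Cauchy by the parallelogram law. *)
Lemma riesz (psi : V -> R[i]) : antilinear psi ->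
  (exists M, forall x, `|complex.Re (psi x)| <= M * n x) ->
  exists u, forall x, ip u x = psi x.
Proof.
move=> lin [M0 bnd0]; have [ipP _] := hV.
pose M := `|M0|; have bnd x : `|complex.Re (psi x)| <= M * n x.
  by apply: le_trans (bnd0 x) _; rewrite ler_wpM2r ?vnorm_ge0 ?ler_norm.
have M_ge0 : 0 <= M by rewrite normr_ge0.
pose J x := n x ^+ 2 - 2 * complex.Re (psi x).
have JD x y : J (x + y) = J x + 2 * complex.Re (ip x y) + n y ^+ 2 - 2 * complex.Re (psi y).
  by rewrite /J vnormD_sqr // antilinearD // raddfD /=; ring.
pose E := [set J x | x in [set: V]]%classic.
have infE : has_inf E.
  split; first by exists (J 0); exists 0.
  exists (- M ^+ 2) => _ [x _ <-]; rewrite /J.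
  have := sqr_ge0 (n x - M); have := bnd x; have := ler_norm (complex.Re (psi x)).
  rewrite sqrrB; lra.
pose m := inf E.
have mJ x : m <= J x by apply: ge_inf; [case: infE | exists x].
(* Parallelogram law, with [m <= J] at the midpoint of [x] and [y]. *)
have Jdist x y : n (x - y) ^+ 2 <= 2 * J x + 2 * J y - 4 * m.
  have := mJ ((2^-1)%:C *: (x + y)); have := parallelogram ipP x y.
  rewrite /J vnormZ // exprMn real_normK ?num_real // antilinear_ReZ //.
  rewrite (antilinearD _ _ lin) raddfD /=; lra.
(* The excess is squared because [Jdist] controls squared distances. *)
have /boolp.choice[x xJ] : forall k : nat, exists y, J y <= m + (1 / 2 ^+ k) ^+ 2.
  move=> k.
  have e0 : 0 < ((1 / 2 ^+ k) ^+ 2 : R) by rewrite exprn_gt0 ?divr_gt0 ?exprn_gt0.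
  by have [_ [y _ <-] /ltW] := inf_adherent e0 infE; exists y.
have c0 k : 0 <= (1 / 2 ^+ k : R) by rewrite divr_ge0 ?exprn_ge0.
have cS k : 1 / 2 ^+ k.+1 = (1 / 2 ^+ k : R) / 2 by rewrite exprS invfM mulrA mulrAC.
have [||k|u [_ ul]] := @geometric_limit x (fun k => 4 * (1 / 2 ^+ k)).
- by move=> k; rewrite mulr_ge0.
- by move=> k; rewrite cS; move: (1 / _) => c; lra.
- rewrite -(@ler_pXn2r _ 2) ?nnegrE ?vnorm_ge0 //; last by have := c0 k; lra.
  have := Jdist (x k.+1) (x k); have := xJ k; have := xJ k.+1; have := c0 k.
  rewrite cS !expr2; set c := 1 / _; nra.
have Ju : J u <= m.
  apply/ler_addgt0Pr => e e0.
  (* With [c = 1 / 2^N <= 1] and [a = |u - x N| <= 4 c], expanding [J] at [x N] gives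
     [J u - m <= c^2 + 2 |x N| a + a^2 + 2 M a], at most [C c] since [|x N| <= |u| + 4]. *)
  pose C := (2 * n u + 12 + 2 * M) * 4 + 1.
  have [N /(_ N (leqnn N))] := exp_half_lt C e0; rewrite -[C]mulr1 -mulrA.
  have := xJ N; have := ul N; have := c0 N.
  have : (1 / 2 ^+ N : R) <= 1 by rewrite ler_pdivrMr ?exprn_gt0// mul1r exprn_ege1 // ler1n.
  set c := 1 / _ => c1 c_ge0.
  have := JD (x N) (u - x N); rewrite addrC subrK => ->.
  have := ler_norm (complex.Re (ip (x N) (u - x N))).
  have := cauchy_schwarz ipP (x N) (u - x N).
  have := ler_norm (- complex.Re (psi (u - x N))); rewrite normrN.
  have := bnd (u - x N).
  have := vnormB ipP u (u - x N); rewrite subKr.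
  have := vnorm_ge0 ip (u - x N); have := vnorm_ge0 ip (x N).
  have := vnorm_ge0 ip u.
  move: (n (u - x N)) (n (x N)) (complex.Re _) (complex.Re _) (J (x N)) => a b r s j.
  rewrite /C; move: (n u) => q *.
  have h1 : b * a <= (q + 4) * a by apply: ler_wpM2r => //; lra.
  have h2 : a * a <= 4 * a by apply: ler_wpM2r => //; lra.
  have h3 : (2 * q + 12 + 2 * M) * a <= (2 * q + 12 + 2 * M) * (4 * c).
    by apply: ler_wpM2l => //; lra.
  have h4 : c ^+ 2 <= c by rewrite expr2 ler_piMl.
  rewrite expr2; lra.
exists u; apply: antilinear_ext => // [a y z|h].
  by rewrite ipDr // ipZr.
apply/subr0_eq; set b := _ - _; set a := n h ^+ 2.
have a1 : 0 < a + 1 by rewrite ltr_wpDl ?ltr01 ?sqr_ge0.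
(* First variation: minimality forces [0 <= 2 t b + t^2 a] for real [t]. The shift by 1 keeps [t]
   defined when [a = 0], and this choice yields [b^2 (a + 2) <= 0]. *)
pose t := - b / (a + 1).
have := mJ (u + t%:C *: h).
rewrite JD ripZr // vnormZ // exprMn real_normK ?num_real // antilinear_ReZ // -/a => Jt.
have : 0 <= 2 * t * b + t ^+ 2 * a by rewrite /b; lra.
have -> : 2 * t * b + t ^+ 2 * a = - (b ^+ 2 * (a + 2) / (a + 1) ^+ 2).
  by rewrite /t; field; rewrite gt_eqF.
rewrite oppr_ge0 pmulr_lle0 ?invr_gt0 ?exprn_gt0 // pmulr_lle0; last by lra.
by move=> b2; apply/eqP; rewrite -sqrf_eq0 eq_le b2 sqr_ge0.
Qed.

End Complete.

(** * A Baire category argument and the closed graph theorem *)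

Section ClosedGraph.
Variables (R : realType) (V W : lmodType R[i]).
Variables (ipV : V -> V -> R[i]) (ipW : W -> W -> R[i]).
Hypotheses (hV : hilbert ipV) (hW : hilbert ipW).
Local Notation nV := (vnorm ipV).
Local Notation nW := (vnorm ipW).

Lemma is_linearD (f : V -> W) x y : is_linear f -> f (x + y) = f x + f y.
Proof. by move=> lin; have := lin 1 x y; rewrite !scale1r. Qed.

Lemma is_linear0 (f : V -> W) : is_linear f -> f 0 = 0.
Proof.
by move=> lin; have := is_linearD 0 0 lin; rewrite addr0 => /(congr1 (fun w => w - f 0));
  rewrite addrK subrr.
Qed.

Lemma is_linearZ (f : V -> W) a x : is_linear f -> f (a *: x) = a *: f x.
Proof. by move=> lin; have := lin a x 0; rewrite is_linear0 ?addr0. Qed.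

Lemma is_linearB (f : V -> W) x y : is_linear f -> f (x - y) = f x - f y.
Proof. by move=> lin; rewrite -scaleN1r is_linearD // is_linearZ // scaleN1r. Qed.

(* Otherwise nested balls would shrink to a point outside every [{y | p y <= k}]. *)
Lemma dense_sublevel (p : V -> R) :
  exists k : nat, exists x0 : V, exists2 r : R, 0 < r &
    forall x, nV (x - x0) < r -> forall e, 0 < e -> exists2 y, p y <= k%:R & nV (x - y) < e.
Proof.
apply: contrapT => neg; have [ipP _] := hV.
(* The positivity premise stands inside the existential, so the choice is total and can be iterated;
   [c0] restores positivity by induction. *)
have next k (c : V * R) : exists c' : V * R, 0 < c.2 ->
    [/\ 0 < c'.2, c'.2 <= c.2 / 2, nV (c'.1 - c.1) <= c.2 / 2 &
        forall y, nV (y - c'.1) <= c'.2 -> k%:R < p y].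
  case: c => x0 r /=; case: (ltrP 0 r) => r0; last by exists (x0, r).
  have r2 : 0 < r / 2 by rewrite divr_gt0.
  apply: contrapT => nc; apply: neg; exists k, x0, (r / 2) => // x xr e e0.
  apply: contrapT => ny; apply: nc.
  (* The bound [e / 2] keeps the closed new ball inside the open [e]-ball about [x]; [r / 2] makes
     the radii halve. *)
  pose e' := Num.min (e / 2) (r / 2).
  have [l1 l2] : e' <= e / 2 /\ e' <= r / 2 by rewrite !ge_min !lexx orbT.
  have e'0 : 0 < e' by rewrite lt_min !divr_gt0.
  exists (x, e') => _ /=; split=> // [|y yx]; first exact: ltW.
  rewrite ltNge; apply/negP => py; apply: ny; exists y => //.
  by rewrite vnormBC //; lra.
pose fix c k : V * R := if k is k'.+1 then projT1 (cid (next k' (c k'))) else (0, 1).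
have c0 k : 0 < (c k).2.
  elim: k => [|k IH]; first by rewrite /= ltr01.
  by have [] := projT2 (cid (next k (c k))) IH.
have cS k : [/\ 0 < (c k.+1).2, (c k.+1).2 <= (c k).2 / 2,
    nV ((c k.+1).1 - (c k).1) <= (c k).2 / 2 &
        forall y, nV (y - (c k.+1).1) <= (c k.+1).2 -> k%:R < p y].
  exact: projT2 (cid (next k (c k))) (c0 k).
have [||k|l [_ lc]] := geometric_limit hV (u := fun k => (c k).1) (d := fun k => (c k).2).
- by move=> k; exact: ltW.
- by move=> k; case: (cS k).
- by case: (cS k).
have pl k : k%:R < p l by case: (cS k) => _ _ _; apply; exact: lc.
have := pl (Num.bound `|p l|); apply/negP; rewrite -leNgt.
by apply: le_trans (ler_norm _) _; apply: ltW; apply: archi_boundP.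
Qed.

Definition closed_graph (f : V -> W) :=
  forall u x y, converges ipV u x -> converges ipW (fun k => f (u k)) y -> f x = y.

(** A sublevel set of [|f|] is dense in some ball. Recentring at 0 and scaling allow successive
    approximation of [x] with geometrically decreasing images; these sum in [W], and the closed
    graph identifies the sum with [f x]. *)
Lemma closed_graph_bounded (f : V -> W) :
  is_linear f -> closed_graph f -> bounded_wrt nV nW f.
Proof.
move=> lin cl; have [ipPV _] := hV; have [ipPW _] := hW.
have [k [x0 [r r0 dense]]] := dense_sublevel (fun y => nW (f y)).
pose c : R := 2 * k%:R; have c_ge0 : 0 <= c by rewrite mulr_ge0.
(* Approximate [x + x0] and [x0] separately and subtract; hence the factor 2 in [c]. *)
have dense0 x e : nV x < r -> 0 < e -> exists2 y, nW (f y) <= c & nV (x - y) < e.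
  move=> xr e0; have e2 : 0 < e / 2 by rewrite divr_gt0.
  have [|y1 fy1 xy1] := dense (x + x0) _ _ e2; first by rewrite addrK.
  have [|y0 fy0 xy0] := dense x0 _ _ e2; first by rewrite subrr vnorm0.
  exists (y1 - y0).
    by rewrite is_linearB //; have := vnormB ipPW (f y1) (f y0); rewrite /c; lra.
  have -> : x - (y1 - y0) = (x + x0 - y1) - (x0 - y0).
    by rewrite [x + x0 - y1]addrAC [RHS]addrKA opprD addrA.
  by have := vnormB ipPV (x + x0 - y1) (x0 - y0); lra.
have denses (s : R) x e : 0 < s -> nV x < r * s -> 0 < e ->
    exists2 y, nW (f y) <= c * s & nV (x - y) < e.
  move=> s0 xr e0.
  have [||y fy xy] := dense0 (s^-1%:C *: x) (e / s).
  - by rewrite vnormZ // gtr0_norm ?invr_gt0// mulrC ltr_pdivrMr.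
  - by rewrite divr_gt0.
  have sK : x = s%:C *: (s^-1%:C *: x).
    by rewrite scalerA -rmorphM /= divff ?scale1r // gt_eqF.
  exists (s%:C *: y).
    by rewrite is_linearZ // vnormZ // gtr0_norm // mulrC ler_pM2r.
  by rewrite sK -scalerBr vnormZ // gtr0_norm // mulrC -ltr_pdivlMr.
have small x : nV x < r -> nW (f x) <= 2 * c.
  move=> xr.
  pose h i : R := 1 / 2 ^+ i.
  have h0 i : 0 < h i by rewrite divr_gt0 ?exprn_gt0.
  have hS i : h i.+1 = h i / 2 by rewrite /h exprS invfM mulrA mulrAC.
  (* Each correction approximates the current remainder at scale [h i]. *)
  have next i (s : V) : exists s', nV (x - s) < r * h i ->
      nV (x - s') < r * h i.+1 /\ nW (f s' - f s) <= c * h i.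
    case: (ltrP (nV (x - s)) (r * h i)) => xs; last by exists 0.
    have [|y fy xy] := denses _ _ (r * h i.+1) (h0 i) xs; first by rewrite mulr_gt0.
    exists (s + y) => _; split; first by rewrite opprD addrA.
    by rewrite is_linearD // addrAC subrr add0r.
  pose fix s i : V := if i is i'.+1 then projT1 (cid (next i' (s i'))) else 0.
  have sx i : nV (x - s i) < r * h i.
    elim: i => [|i IH]; first by rewrite subr0 /h expr0 divr1 mulr1.
    by have [] := projT2 (cid (next i (s i))) IH.
  have fs i : nW (f (s i.+1) - f (s i)) <= c * h i.
    by have [] := projT2 (cid (next i (s i))) (sx i).
  have [|||w [fsw wl]] := geometric_limit hW (u := fun i => f (s i)) (d := fun i => 2 * c * h i).
  - by move=> i; rewrite mulr_ge0 ?(ltW (h0 i)) // mulr_ge0.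
  - by move=> i; rewrite hS; lra.
  - by move=> i; apply: le_trans (fs i) _; lra.
  have -> : f x = w.
    apply: cl fsw => e e0.
    have [N hN] := exp_half_lt r e0; exists N => i /hN; rewrite vnormBC //.
    by apply: lt_trans; have := sx i; rewrite /h mul1r.
  by have := wl 0%N; rewrite is_linear0 // subr0 /h expr0 divr1 mulr1.
(* Rescale [x] to norm [r / 2], where [small] gives [2 * c]. *)
exists (4 * c / r) => x.
have [/eqP/(vnorm0_eq0 ipPV)->|nx0] := boolP (nV x == 0).
  by rewrite is_linear0 // !vnorm0 // mulr0.
have nx : 0 < nV x by rewrite lt_def nx0 vnorm_ge0.
have t0 : 0 < r / (2 * nV x) by rewrite divr_gt0 // mulr_gt0.
have := small ((r / (2 * nV x))%:C *: x).
rewrite is_linearZ // !vnormZ // (gtr0_norm t0).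
have -> : r / (2 * nV x) * nV x = r / 2 by field.
have -> : r / (2 * nV x) * nW (f x) = nW (f x) * r / (2 * nV x) by field.
rewrite ler_pdivrMr ?mulr_gt0 // => fx.
have {}fx := fx ltac:(lra); rewrite mulrAC ler_pdivlMr //; lra.
Qed.

End ClosedGraph.

(** * Elementary estimates for graph and sum norms, bounds and moduli *)

Lemma le_hypotl (R : realType) (a b : R) : 0 <= a -> a <= Num.sqrt (a ^+ 2 + b ^+ 2).
Proof.
move=> a0; rewrite -{1}(ger0_norm a0) -sqrtr_sqr ler_sqrt ?addr_ge0 ?sqr_ge0 //.
by rewrite lerDl sqr_ge0.
Qed.

Lemma le_hypotr (R : realType) (a b : R) : 0 <= b -> b <= Num.sqrt (a ^+ 2 + b ^+ 2).
Proof. by rewrite addrC; exact: le_hypotl. Qed.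

Lemma hypot_le (R : realType) (a b : R) :
  0 <= a -> 0 <= b -> Num.sqrt (a ^+ 2 + b ^+ 2) <= a + b.
Proof.
move=> a0 b0; rewrite -[leRHS]ger0_norm ?addr_ge0 // -sqrtr_sqr ler_sqrt ?sqr_ge0 //.
by rewrite sqrrD lerD2r lerDl mulrn_wge0 // mulr_ge0.
Qed.

Lemma bounded_ge0 (R : realType) (X Y : Type) (nX : X -> R) (nY : Y -> R)
    (S : X -> Prop) (f : X -> Y) :
  (forall x, 0 <= nX x) -> (exists M, forall x, S x -> nY (f x) <= M * nX x) ->
  exists2 M, 0 <= M & forall x, S x -> nY (f x) <= M * nX x.
Proof.
move=> nX0 [M bM]; exists `|M| => // x Sx.
by apply: le_trans (bM x Sx) _; rewrite ler_wpM2r ?ler_norm.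
Qed.

Lemma bounded_wrt_ge0 (R : realType) (X Y : Type) (nX : X -> R) (nY : Y -> R) (f : X -> Y) :
  (forall x, 0 <= nX x) -> bounded_wrt nX nY f ->
  exists2 M, 0 <= M & forall x, nY (f x) <= M * nX x.
Proof.
move=> nX0 [M bM].
have [|N N0 bN] := @bounded_ge0 R X Y nX nY (fun=> True) f nX0; first by exists M.
by exists N => // x; apply: bN.
Qed.

Lemma Re_le_cabs (R : realType) (z : R[i]) : `|complex.Re z| <= cabs z.
Proof. by rewrite -sqrtr_sqr ler_sqrt ?addr_ge0 ?sqr_ge0 // lerDl sqr_ge0. Qed.

Lemma cabsZ (R : realType) (a : R) (z : R[i]) : cabs (a%:C * z) = `|a| * cabs z.
Proof.
rewrite /cabs; case: z => b c /=.
rewrite !mul0r subr0 addr0 !exprMn -mulrDr sqrtrM ?sqr_ge0 // sqrtr_sqr //.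
Qed.

(** * The dual norm on [K'] *)

Section DualNorm.
Variables (R : realType) (K : lmodType R[i]) (ip : K -> K -> R[i]).
Hypothesis ipP : inner_product ip.
Local Notation n := (vnorm ip).

Lemma cabs_ball_le_dnorm phi x :
  antidual ip phi -> n x <= 1 -> cabs (phi x) <= dnorm ip phi.
Proof.
move=> [lin [M bM]] x1; apply: ub_le_sup; last by exists x.
exists `|M| => _ [z z1 <-]; apply: le_trans (bM z) _.
apply: le_trans (_ : `|M| * n z <= _); first by rewrite ler_wpM2r ?vnorm_ge0 ?ler_norm.
by rewrite ler_piMr.
Qed.

Lemma cabs_le_dnorm phi x : antidual ip phi -> cabs (phi x) <= dnorm ip phi * n x.
Proof.
move=> phiK; have [lin _] := phiK.
have [/eqP/(vnorm0_eq0 ipP)->|nx0] := boolP (n x == 0).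
  by rewrite (antilinear0 lin) vnorm0 // mulr0 /cabs /= expr0n addr0 sqrtr0.
have nx : 0 < n x by rewrite lt_def nx0 vnorm_ge0.
have := cabs_ball_le_dnorm (x := (n x)^-1%:C *: x) phiK.
rewrite vnormZ // gtr0_norm ?invr_gt0 // mulVf // lexx => /(_ isT).
rewrite (antilinearZ _ _ lin) conjE conjc_real cabsZ gtr0_norm ?invr_gt0 //.
by rewrite mulrC ler_pdivrMr.
Qed.

Lemma dual_norm_ge0 phi : antidual ip phi -> 0 <= dnorm ip phi.
Proof.
move=> /(cabs_ball_le_dnorm (x := 0)); rewrite vnorm0 // ler01 => /(_ isT).
exact: le_trans (sqrtr_ge0 _).
Qed.

End DualNorm.

(** * Continuity of bounded maps; linearity of adjoints *)

Lemma converges_bounded (R : realType) (V W : lmodType R[i]) (ipV : V -> V -> R[i])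
    (ipW : W -> W -> R[i]) (f : V -> W) (u : nat -> V) l :
  is_linear f -> bounded_wrt (vnorm ipV) (vnorm ipW) f ->
  converges ipV u l -> converges ipW (fun k => f (u k)) (f l).
Proof.
move=> lin bf ul e e0.
have [|M M0 bM] := bounded_wrt_ge0 _ bf; first by move=> x; exact: vnorm_ge0.
have M1 : 0 < M + 1 by rewrite ltr_wpDl.
have [N hN] := ul (e / (M + 1)) (divr_gt0 e0 M1).
exists N => k /hN; rewrite ltr_pdivlMr // -is_linearB //; have := bM (u k - l).
by have := vnorm_ge0 ipV (u k - l); lra.
Qed.

(** The domain is a subspace by its defining condition; the defect of linearity of [Ts] is
    orthogonal to the dense [D], hence zero. *)
Lemma adjoint_lin_op (R : realType) (V : lmodType R[i]) (ip : V -> V -> R[i])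
    (D Ds : V -> Prop) (T Ts : V -> V) :
  inner_product ip -> dense_wrt (vnorm ip) D -> is_adjoint ip D T Ds Ts -> lin_op Ds Ts.
Proof.
move=> ipP dD [DsP TsP].
have DsZ a x y : Ds x -> Ds y -> Ds (a *: x + y).
  move=> Dx Dy; apply/DsP; exists (a *: Ts x + Ts y) => u Du.
  by rewrite !ipDr // !ipZr // !TsP.
split; first split=> //.
  by apply/DsP; exists 0 => u _; rewrite !ip0r.
move=> a x y Dx Dy; apply/subr0_eq; apply: (dense_ortho ipP dD) => u Du.
rewrite (ipC ipP u) ipBr // -TsP //; last exact: DsZ.
by rewrite !ipDr // !ipZr // !TsP // subrr rmorph0.
Qed.

Theorem theorem4p5 (R : realType)
  (* the Hilbert space H0 and the operator T with adjoint Tstar = (Ds, Ts) *)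
  (H0 : lmodType R[i]) (ip0 : H0 -> H0 -> R[i])
  (D : H0 -> Prop) (T : H0 -> H0) (Ds : H0 -> Prop) (Ts : H0 -> H0)
  (* H1 with bounded inclusion iota into H0 *)
  (H1 : lmodType R[i]) (ip1 : H1 -> H1 -> R[i]) (iota : H1 -> H0)
  (* K^∂ and K with bounded inclusion j into K^∂ *)
  (Kd : lmodType R[i]) (ipd : Kd -> Kd -> R[i])
  (K : lmodType R[i]) (ipK : K -> K -> R[i]) (j : K -> Kd)
  (* boundary maps *)
  (g0 g1 : H1 -> K)
  (* the continuous extension Γ0 : D(Tstar) -> K' *)
  (G0 : H0 -> (K -> R[i]))
  (* the operator A = (DA, Af) *)
  (DA : H0 -> Prop) (Af : H0 -> H0) :
  (* H0 separable Hilbert space; T closed densely defined symmetric with adjoint Tstar *)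
  hilbert ip0 -> separable ip0 ->
  lin_op D T -> dense_wrt (vnorm ip0) D -> closed_op ip0 D T -> symmetric_op ip0 D T ->
  is_adjoint ip0 D T Ds Ts ->
  (* H1 Hilbert space, dense in H0, bounded inclusion *)
  hilbert ip1 -> is_linear iota -> (forall x y, iota x = iota y -> x = y) ->
  bounded_wrt (vnorm ip1) (vnorm ip0) iota ->
  dense_wrt (vnorm ip0) (fun v => exists u, v = iota u) ->
  (* K^∂ separable Hilbert space, K dense Hilbert subspace with bounded inclusion *)
  hilbert ipd -> separable ipd ->
  hilbert ipK -> is_linear j -> (forall x y, j x = j y -> x = y) ->
  bounded_wrt (vnorm ipK) (vnorm ipd) j ->
  dense_wrt (vnorm ipd) (fun y => exists x, y = j x) ->
  (* standing assumptions *)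
  (forall u : H1, Ds (iota u)) ->
  (forall v, Ds v -> forall e : R, 0 < e -> exists u : H1, graphnorm ip0 Ts (v - iota u) < e) ->
  bounded_wrt (vnorm ip1) (vnorm ip0) (fun u => Ts (iota u)) ->
  is_linear g0 -> is_linear g1 ->
  bounded_wrt (vnorm ip1) (vnorm ipK) g0 -> bounded_wrt (vnorm ip1) (vnorm ipK) g1 ->
  (forall a b : K, exists u : H1, g0 u = a /\ g1 u = b) ->
  dense_wrt (vnorm ip0) (fun v => exists u, g0 u = 0 /\ g1 u = 0 /\ v = iota u) ->
  (forall v, D v <-> exists u, g0 u = 0 /\ g1 u = 0 /\ v = iota u) ->
  (forall u v : H1,
      ip0 (Ts (iota u)) (iota v) - ip0 (iota u) (Ts (iota v))
      = ipd (j (g1 u)) (j (g0 v)) - ipd (j (g0 u)) (j (g1 v))) ->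
  (* Γ0 is the continuous extension of γ0 to (D(Tstar), graph norm) with values in K' *)
  (forall v, Ds v -> antidual ipK (G0 v)) ->
  (forall (a : R[i]) v w, Ds v -> Ds w ->
      G0 (a *: v + w) = (fun x => a * G0 v x + G0 w x)) ->
  (exists M : R, forall v, Ds v -> dnorm ipK (G0 v) <= M * graphnorm ip0 Ts v) ->
  (forall u : H1, G0 (iota u) = (fun x => ipd (j (g0 u)) (j x))) ->
  (* the operator A *)
  is_adjoint ip0 DA Af DA Af ->
  (forall v, D v -> DA v /\ Af v = T v) ->
  (forall v, DA v -> Ds v /\ Af v = Ts v) ->
  (forall v, DA v <-> exists u, g0 u = 0 /\ v = iota u) ->
  (exists B : H0 -> H0, is_linear B /\ bounded_wrt (vnorm ip0) (vnorm ip0) B /\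
      (forall f, DA (B f) /\ Af (B f) = f) /\ (forall v, DA v -> B (Af v) = v)) ->
  (* conclusions *)
  top_iso (fun v => Ds v /\ Ts v = 0) (antidual ipK)
          (graphnorm ip0 Ts) (dnorm ipK) G0 /\
  top_iso Ds (fun p : H0 * (K -> R[i]) => antidual ipK p.2)
          (graphnorm ip0 Ts) (sumnorm ip0 ipK) (fun v => (Ts v, G0 v)).
Proof.
move=> h0 _ _ dD _ _ adjT h1 iotal iotaI iotab _ hd _ hK jl _ _ _ H1Ds dH1 Tsb g0l g1l g0b g1b gs
  _ DP lagrange G0K G0l G0b G0g _ DDA DADs DAP [B [Bl [Bb [BA AB]]]].
have [ip0P _] := h0; have [ip1P _] := h1; have [ipdP _] := hd; have [ipKP _] := hK.
have [[Ds0 DsZ] Tsl] := adjoint_lin_op ip0P dD adjT.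
pose n := vnorm ip0; pose gn := graphnorm ip0 Ts.
have n_ge0 x : 0 <= n x by exact: vnorm_ge0.
have gn_ge0 x : 0 <= gn x by exact: sqrtr_ge0.
have n_gn x : n x <= gn x by apply: le_hypotl; exact: n_ge0.
have nT_gn x : n (Ts x) <= gn x by apply: le_hypotr; exact: n_ge0.
have gn_le x : gn x <= n x + n (Ts x) by apply: hypot_le; exact: n_ge0.
have DsB x y : Ds x -> Ds y -> Ds (x - y).
  by move=> Dx Dy; rewrite -scaleN1r addrC; exact: DsZ.
have TsB x y : Ds x -> Ds y -> Ts (x - y) = Ts x - Ts y.
  by move=> Dx Dy; rewrite -scaleN1r addrC Tsl // scaleN1r addrC.
have G0B x y z : Ds x -> Ds y -> G0 (x - y) z = G0 x z - G0 y z.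
  by move=> Dx Dy; rewrite -scaleN1r addrC G0l // mulN1r addrC.
have BDs f : Ds (B f) /\ Ts (B f) = f.
  by have [DAB ABf] := BA f; have [? <-] := DADs _ DAB.

(* The inverse of [A] as a bounded map into [H1] *)
have /boolp.choice[L LP] : forall f, exists u, g0 u = 0 /\ B f = iota u.
  by move=> f; apply/DAP; case: (BA f).
have L_unique v : g0 v = 0 -> L (Ts (iota v)) = v.
  move=> gv; apply: iotaI; have [_ <-] := LP (Ts (iota v)).
  have DAv : DA (iota v) by apply/DAP; exists v.
  by have [_ <-] := DADs _ DAv; exact: AB.
have Ll : is_linear L.
  move=> a x y; apply: iotaI; rewrite iotal.
  by have [_ <-] := LP (a *: x + y); have [_ <-] := LP x; have [_ <-] := LP y; rewrite Bl.
have Tsil : is_linear (fun u => Ts (iota u)).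
  by move=> a x y; rewrite iotal Tsl.
(* If [u k -> x] and [L (u k) -> y] in [H1], boundedness of [g0] and of [Ts] on [H1] gives
   [g0 y = 0] and [Ts (iota y) = x], so [y = L x]. *)
have Lb : bounded_wrt n (vnorm ip1) L.
  apply: (closed_graph_bounded h0 h1 Ll) => u x y ux Luy.
  have TsL k : Ts (iota (L (u k))) = u k.
    by have [_ <-] := LP (u k); case: (BDs (u k)).
  have gy : g0 y = 0.
    apply: (converges_unique ipKP (converges_bounded g0l g0b Luy)) => e e0.
    by exists 0%N => k _; have [-> _] := LP (u k); rewrite subrr vnorm0.
  rewrite -[RHS]L_unique //; congr L.
  apply: (converges_unique ip0P ux); have := converges_bounded Tsil Tsb Luy.
  by congr (converges _ _ _); apply/funext => k; rewrite TsL.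
pose P f := g1 (L f).
have [C C0 Pb] : exists2 C, 0 <= C & forall f, vnorm ipK (P f) <= C * n f.
  have [M1 M10 bM1] := bounded_wrt_ge0 n_ge0 Lb.
  have [M2 M20 bM2] := bounded_wrt_ge0 (@vnorm_ge0 _ _ ip1) g1b.
  exists (M2 * M1) => [|f]; first exact: mulr_ge0.
  by apply: le_trans (bM2 _) _; rewrite -mulrA ler_wpM2l.
have [M M0 G0M] := bounded_ge0 gn_ge0 G0b.
have [MB MB0 BM] := bounded_wrt_ge0 n_ge0 Bb.
have ReG0 u x : Ds u -> `|complex.Re (G0 u x)| <= dnorm ipK (G0 u) * vnorm ipK x.
  by move=> Du; apply: le_trans (Re_le_cabs _) _; apply: cabs_le_dnorm => //; exact: G0K.
(* Only [v] in [ker g0] is tested, so the extension of [g1] to [Ds] plays no role. *)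
have green u f : Ds u ->
    complex.Re (ip0 u f) = complex.Re (ip0 (Ts u) (B f)) + complex.Re (G0 u (P f)).
  move=> Du; apply/esym/subr0_eq.
  (* The defect [E] vanishes on [H1] by the Lagrange identity tested with [L f], and it is bounded
     in the graph norm, in which [H1] is dense. *)
  pose E v := complex.Re (ip0 (Ts v) (B f)) + complex.Re (G0 v (P f)) - complex.Re (ip0 v f).
  have Ei w : E (iota w) = 0.
    have := lagrange w (L f); have [-> <-] := LP f; have [_ ->] := BDs f.
    rewrite is_linear0 // ip0r // sub0r /E G0g -/(P f).
    move=> /(congr1 (@complex.Re R)); rewrite !raddfB raddfN /=; lra.
  have EB v w : Ds v -> Ds w -> E (v - w) = E v - E w.
    by move=> Dv Dw; rewrite /E TsB // G0B // !ipBl // !raddfB /=; lra.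
  pose c := n (B f) + M * vnorm ipK (P f) + n f.
  have Eb v : Ds v -> `|E v| <= c * gn v.
    move=> Dv; rewrite /E; apply: le_trans (ler_normB _ _) _.
    apply: le_trans (lerD (ler_normD _ _) (lexx _)) _.
    have := cauchy_schwarz ip0P (Ts v) (B f); have := cauchy_schwarz ip0P v f.
    have := ReG0 v (P f) Dv.
    have : dnorm ipK (G0 v) * vnorm ipK (P f) <= M * gn v * vnorm ipK (P f).
      by rewrite ler_wpM2r ?vnorm_ge0 // G0M.
    have : n v * n f <= gn v * n f by rewrite ler_wpM2r.
    have : n (Ts v) * n (B f) <= gn v * n (B f) by rewrite ler_wpM2r.
    rewrite /c -/n; lra.
  have c_ge0 : 0 <= c by rewrite !addr_ge0 // mulr_ge0 // vnorm_ge0.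
  apply/eqP; rewrite -normr_le0 -/(E u); apply/ler_addgt0Pr => e e0; rewrite add0r.
  have c1 : 0 < c + 1 by rewrite ltr_wpDl.
  have [w] := dH1 u Du (e / (c + 1)) (divr_gt0 e0 c1).
  rewrite ltr_pdivlMr // -/(gn _) => uw.
  have := Eb (u - iota w) (DsB _ _ Du (H1Ds w)); rewrite EB // Ei subr0.
  by have := gn_ge0 (u - iota w); lra.

(* [G0] on the kernel of [Ts]: lower bound, injectivity, surjectivity *)
have ker_bound u : Ds u -> Ts u = 0 -> n u <= C * dnorm ipK (G0 u).
  move=> Du Tu; have := green u u Du; rewrite Tu ip0l // add0r -vnorm_sqr // -/n => nu.
  have [->|nu0] := eqVneq (n u) 0.
    by apply: mulr_ge0 => //; apply: dual_norm_ge0 => //; exact: G0K.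
  have nu_gt0 : 0 < n u by rewrite lt_def nu0 n_ge0.
  rewrite -(ler_pM2r nu_gt0) -expr2 nu; apply: le_trans (ler_norm _) _.
  apply: le_trans (ReG0 _ _ Du) _; rewrite mulrAC [C * _ * _]mulrC.
  by apply: ler_wpM2l; [apply: dual_norm_ge0 => //; exact: G0K|exact: Pb].
have ker_inj u : Ds u -> Ts u = 0 -> (forall x, G0 u x = 0) -> u = 0.
  move=> Du Tu Gu; apply: (vnorm0_eq0 ip0P); apply/eqP; rewrite -sqrf_eq0 vnorm_sqr //.
  by rewrite green // Tu ip0l // Gu addr0.
have ker_surj phi : antidual ipK phi -> exists u, [/\ Ds u, Ts u = 0 & G0 u = phi].
  move=> phiK; have [phil [N phib]] := phiK.
  have PL : is_linear P by move=> a x y; rewrite /P Ll g1l.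
  have [||u uP] := riesz h0 (psi := fun f => phi (P f)).
  - by move=> a x y; rewrite PL phil.
  - exists (dnorm ipK phi * C) => f; apply: le_trans (Re_le_cabs _) _.
    apply: le_trans (cabs_le_dnorm ipKP _ phiK) _.
    by rewrite -mulrA; apply: ler_wpM2l; [exact: dual_norm_ge0|exact: Pb].
  (* [D] consists of vectors with both boundary values zero, so [P (T v) = 0]: the Riesz vector is
     orthogonal to the range of [T], whence [Ts u = 0]. *)
  have uT v : D v -> ip0 (T v) u = 0.
    move=> Dv; have [w [gw [g1w vw]]] := (DP v).1 Dv.
    have [DAv <-] := DDA v Dv; have [_ ->] := DADs v DAv.
    by rewrite (ipC ip0P u) uP vw /P L_unique // g1w (antilinear0 phil) rmorph0.
  have Du : Ds u by apply/adjT.1; exists 0 => v Dv; rewrite uT // ip0r.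
  have Tu : Ts u = 0.
    apply: (dense_ortho ip0P dD) => v Dv.
    by rewrite (ipC ip0P v) -adjT.2 // uT // rmorph0.
  exists u; split=> //; apply/funext.
  apply: antilinear_ext; [exact: (G0K u Du).1|exact: phil|move=> x].
  (* Surjectivity of the boundary maps makes every [x] a value of [P], namely at [Ts (iota v)]. *)
  have [v [gv g1v]] := gs 0 x.
  have := green u (Ts (iota v)) Du.
  by rewrite Tu ip0l // add0r uP /P L_unique // g1v.

(* Splitting off the range of [B], and the two isomorphisms *)
have BP f : forall x, G0 (B f) x = 0.
  by move=> x; have [gL ->] := LP f; rewrite G0g gL is_linear0 // ip0l.
have ker_part v : Ds v -> [/\ Ds (v - B (Ts v)), Ts (v - B (Ts v)) = 0 & G0 (v - B (Ts v)) = G0 v].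
  move=> Dv; have [DB TB] := BDs (Ts v).
  split; [exact: DsB|by rewrite TsB // TB subrr|].
  by apply/funext => x; rewrite G0B // BP subr0.
split; split.
- by move=> v [Dv _]; exact: G0K.
- move=> x y [Dx Tx] [Dy Ty] Gxy; apply/subr0_eq/ker_inj; first exact: DsB.
    by rewrite TsB // Tx Ty subrr.
  by move=> z; rewrite G0B // Gxy subrr.
- by move=> phi /ker_surj[u [Du Tu Gu]]; exists u.
- by exists M => v [Dv _]; exact: G0M.
- exists C => v [Dv Tv]; apply: le_trans (gn_le v) _.
  by rewrite Tv [n 0]vnorm0 // addr0; exact: ker_bound.
- by move=> v Dv /=; exact: G0K.
- move=> x y Dx Dy [Txy Gxy]; apply/subr0_eq/ker_inj; first exact: DsB.
    by rewrite TsB // Txy subrr.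
  by move=> z; rewrite G0B // Gxy subrr.
- move=> [f phi] /= /ker_surj[u [Du Tu Gu]]; have [DB TB] := BDs f.
  (* [B f] supplies [f] with zero boundary value, [u] supplies [phi] from the kernel; the factor 1
     matches the form of the linearity facts. *)
  have eq1 : B f + u = 1 *: B f + u by rewrite scale1r.
  exists (B f + u); rewrite eq1; first exact: DsZ.
  rewrite Tsl // G0l // TB Tu Gu scale1r addr0; congr pair.
  by apply/funext => x; rewrite BP mulr0 add0r.
- exists (1 + M) => v Dv; rewrite mulrDl mul1r.
  apply: le_trans (hypot_le _ _) _; rewrite ?vnorm_ge0 ?dual_norm_ge0 //=; first exact: G0K.
  by apply: lerD; [exact: nT_gn|exact: G0M].
(* [C] bounds the kernel part of [v], [MB] the part [B (Ts v)], and 1 the term [|Ts v|] of the graph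
   norm. *)
- exists (C + MB + 1) => v Dv; set s := sumnorm _ _ _.
  have s1 : n (Ts v) <= s by apply: le_hypotl; exact: n_ge0.
  have s2 : dnorm ipK (G0 v) <= s by apply: le_hypotr; apply: dual_norm_ge0 => //; exact: G0K.
  have [Dk Tk Gk] := ker_part v Dv.
  have := ker_bound _ Dk Tk; rewrite Gk => k1.
  have := vnormD ip0P (v - B (Ts v)) (B (Ts v)); rewrite subrK -/n => k2.
  have := gn_le v; have := BM (Ts v).
  have : C * dnorm ipK (G0 v) <= C * s by rewrite ler_wpM2l.
  have : MB * n (Ts v) <= MB * s by rewrite ler_wpM2l.
  rewrite -/gn -/n; lra.
Qed.
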